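(* If a metric space $(X,d)$ is scalable (four-point scalable in the large), then $C(X,d)=C_0(X,d)$.
   Context: For a metric space $(X,d)$ and $\mu,\delta \geq 0$, say that $(X,d)$ satisfies the $(\mu,\delta)$-four-point inequality if for all $x,y,z,w\in X$, $d(x,y)+d(z,w)\le \mu\max\{d(x,z)+d(y,w),\ d(x,w)+d(y,z)\}+2\delta$. The quasi-hyperbolicity constant of $(X,d)$ is $C(X,d)=\inf\{\mu\geq 0\mid \text{there exists }\delta\geq 0\text{ such that }(X,d)\text{ satisfies the }(\mu,\delta)\text{-four-point inequality}\}$, and the quadrilateral constant is $C_0(X,d)=\inf\{\mu\geq 0 \mid (X,d)\text{ satisfies the }(\mu,0)\text{-four-point inequality}\}$. $(X,d)$ is four-point scalable in the large (abbreviated scalable) if for every $x_1,x_2,x_3,x_4\in X$ and every $\lambda\geq 0$ there exist $x_1',x_2',x_3',x_4'\in X$ and $\Lambda\geq\lambda$ such that $d(x_i',x_j')=\Lambda\, d(x_i,x_j)$ for $1\leq i,j\leq 4$. *)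

(* Defs.v *)
From HB Require Import structures.
From mathcomp Require Import all_boot all_order all_algebra lra.
From mathcomp Require Import all_classical all_reals all_analysis.

Set Implicit Arguments.
Unset Strict Implicit.
Unset Printing Implicit Defensive.

Import Order.TTheory GRing.Theory Num.Theory.

Local Open Scope classical_set_scope.
Local Open Scope ring_scope.

Definition four_point_inequality (R : realType) (X : metricType R)
    (mu delta : R) : Prop :=
  forall x y z w : X,
    mdist x y + mdist z w <=
      mu * Num.max (mdist x z + mdist y w) (mdist x w + mdist y z)
      + 2 * delta.

Definition quasi_hyperbolicity_set (R : realType) (X : metricType R) : set R :=
  [set mu | 0 <= mu /\
    exists delta : R, 0 <= delta /\ four_point_inequality X mu delta].

Definition quadrilateral_set (R : realType) (X : metricType R) : set R :=
  [set mu | 0 <= mu /\ four_point_inequality X mu 0].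

Definition quasi_hyperbolicity_constant (R : realType) (X : metricType R) : R :=
  inf (quasi_hyperbolicity_set X).

Definition quadrilateral_constant (R : realType) (X : metricType R) : R :=
  inf (quadrilateral_set X).

Definition four_point_scalable (R : realType) (X : metricType R) : Prop :=
  forall (x : 'I_4 -> X) (lambda : R), 0 <= lambda ->
    exists (x' : 'I_4 -> X) (Lambda : R), lambda <= Lambda /\
      forall i j : 'I_4, mdist (x' i) (x' j) = Lambda * mdist (x i) (x j).

(* [inf] is total and returns 0 on sets that are empty or unbounded below. The
   next lemmas show that this convention is never used above: every metric
   space satisfies the (2, 0)-four-point inequality. *)

Lemma four_point_inequality20 (R : realType) (X : metricType R) :
  four_point_inequality X 2 0.
Proof.
move=> x y z w.
have := metric_triangle x z y; have := metric_triangle x w y.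
have := metric_triangle z x w; have := metric_triangle z y w.
rewrite (metric_sym z x) (metric_sym z y) (metric_sym w y).
set a := mdist x z + mdist y w; set b := mdist x w + mdist y z.
have : a <= Num.max a b by rewrite le_max lexx.
have : b <= Num.max a b by rewrite le_max lexx orbT.
by move: (Num.max a b) => m; rewrite /a /b; lra.
Qed.

Lemma has_inf_quadrilateral_set (R : realType) (X : metricType R) :
  has_inf (quadrilateral_set X).
Proof.
split; last by exists 0 => mu [].
by exists 2; split; [exact: ler0n | exact: four_point_inequality20].
Qed.

Lemma has_inf_quasi_hyperbolicity_set (R : realType) (X : metricType R) :
  has_inf (quasi_hyperbolicity_set X).
Proof.
split; last by exists 0 => mu [].
exists 2; split; first exact: ler0n.
by exists 0; split; [exact: lexx | exact: four_point_inequality20].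
Qed.

(* Main.v *)
Require Import Defs.
From mathcomp Require Import all_boot all_order all_algebra lra.
From mathcomp Require Import all_classical all_reals all_analysis.

(** The two sets of admissible constants coincide, so their infima do.
    The four-point inequality is homogeneous in the distances except for the
    term [2 * delta].  In a scalable space any quadruple has copies magnified
    by arbitrarily large factors [Lambda]; applying the inequality to a copy
    and dividing by [Lambda] leaves the error [2 * delta / Lambda], which can
    be made smaller than any positive defect of the original quadruple. *)

Import Order.TTheory GRing.Theory Num.Theory.

Local Open Scope classical_set_scope.
Local Open Scope ring_scope.

(** A positive defect [e] of a quadruple in the inequality with
    [delta = 0] becomes [Lambda * e] on its magnified copy, where it is at
    most [2 * delta]; this fails once [Lambda] is at least
    [(2 * delta + 1) / e]. *)
Lemma four_point_inequality_scalable0 (R : realType) (X : metricType R)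
    (mu delta : R) :
  four_point_scalable X -> 0 <= delta ->
  four_point_inequality X mu delta -> four_point_inequality X mu 0.
Proof.
move=> hX delta0 hmu x y z w; rewrite mulr0 addr0 leNgt; apply/negP.
rewrite -subr_gt0; set e := _ - _ => e0.
have lambda0 : 0 <= (2 * delta + 1) / e by apply: divr_ge0; lra.
have [q [Lambda [leL dq]]] :=
  hX (fun i => nth x [:: x; y; z; w] i) _ lambda0.
have L0 : 0 <= Lambda := le_trans lambda0 leL.
have Le : 2 * delta + 1 <= Lambda * e by rewrite -ler_pdivrMr.
have := hmu (q (inord 0)) (q (inord 1)) (q (inord 2)) (q (inord 3)).
rewrite !dq !inordK //= -!mulrDr -maxr_pMr // mulrCA -lerBlDl -mulrBr -/e.
by lra.
Qed.

Theorem proposition2p9 (R : realType) (X : metricType R)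
    (hX : four_point_scalable X) :
  quasi_hyperbolicity_constant X = quadrilateral_constant X.
Proof.
congr inf; apply/seteqP; split=> mu /= [mu0].
  case=> delta [delta0 hmu]; split=> //.
  exact: four_point_inequality_scalable0 hX delta0 hmu.
by split=> //; exists 0.
Qed.
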